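(* Write $$\mathbf x_1=(x_{15},x_{12},x_{24},x_{45},x_{14},x_{25}),\quad \mathbf x_2=(x_{16},x_{12},x_{25},x_{56},x_{15},x_{26}),$$ $$\mathbf x_3=(x_{25},x_{23},x_{34},x_{45},x_{24},x_{35}),\quad \mathbf x_4=(x_{26},x_{23},x_{35},x_{56},x_{25},x_{36}),$$ where the $x_{ij}$ denote complex numbers, and consider the equation $$(\ast)\qquad \partial_\leftarrow M(\mathbf x_1)\,\partial_\rightarrow M(\mathbf x_4)=\partial_\uparrow M(\mathbf x_2)\,\partial_\downarrow M(\mathbf x_3).$$ (1) Suppose complex numbers (all the $x_{ij}$ above other than $x_{36}$) are given such that $\mathbf x_1,\mathbf x_2,\mathbf x_3$ are Cayley-Menger diamonds and $x_{25}H_{245}H_{125}\ne0$. Then there is a unique $x_{36}\in\mathbb C$ such that $(\ast)$ holds. Moreover, for this $x_{36}$, $\mathbf x_4$ is a Cayley-Menger diamond. (2) Suppose complex numbers (all the $x_{ij}$ above other than $x_{14}$) are given such that $\mathbf x_2,\mathbf x_3,\mathbf x_4$ are Cayley-Menger diamonds and $x_{25}H_{256}H_{235}\ne0$. Then there is a unique $x_{14}\in\mathbb C$ such that $(\ast)$ holds. Moreover, for this $x_{14}$, $\mathbf x_1$ is a Cayley-Menger diamond.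
   Context: The Cayley-Menger polynomial is $$M(a,b,c,d,e,f)=\det\begin{bmatrix}0&1&1&1&1\\1&0&b&e&a\\1&b&0&c&f\\1&e&c&0&d\\1&a&f&d&0\end{bmatrix}.$$ A Cayley-Menger diamond is a 6-tuple $(a,b,c,d,e,f)\in\mathbb C^6$ with $M(a,b,c,d,e,f)=0$. Notation for partial derivatives with respect to the positions of the arguments: $\partial_\uparrow M=\partial M/\partial a$, $\partial_\downarrow M=\partial M/\partial c$, $\partial_\leftarrow M=\partial M/\partial e$, $\partial_\rightarrow M=\partial M/\partial f$. $H(p,q,r)=-p^2-q^2-r^2+2pq+2pr+2qr$, and $H_{125}=H(x_{12},x_{15},x_{25})$, $H_{245}=H(x_{24},x_{25},x_{45})$, $H_{256}=H(x_{25},x_{26},x_{56})$, $H_{235}=H(x_{23},x_{25},x_{35})$. *)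

(* Defs.v *)
From mathcomp Require Import all_boot all_order all_algebra.
From mathcomp Require Import reals complex mpoly.

Set Implicit Arguments.
Unset Strict Implicit.
Unset Printing Implicit Defensive.

Import GRing.Theory.
Local Open Scope ring_scope.

Definition pos_a : 'I_6 := @Ordinal 6 0 isT.
Definition pos_b : 'I_6 := @Ordinal 6 1 isT.
Definition pos_c : 'I_6 := @Ordinal 6 2 isT.
Definition pos_d : 'I_6 := @Ordinal 6 3 isT.
Definition pos_e : 'I_6 := @Ordinal 6 4 isT.
Definition pos_f : 'I_6 := @Ordinal 6 5 isT.

Definition CM_mx (K : comNzRingType) : 'M[{mpoly K[6]}]_5 :=
  let a := 'X_pos_a in let b := 'X_pos_b in let c := 'X_pos_c in
  let d := 'X_pos_d in let e := 'X_pos_e in let f := 'X_pos_f in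
  \matrix_(i < 5, j < 5)
    nth 0 (nth [::]
      [:: [:: 0; 1; 1; 1; 1];
          [:: 1; 0; b; e; a];
          [:: 1; b; 0; c; f];
          [:: 1; e; c; 0; d];
          [:: 1; a; f; d; 0]] i) j.

Definition CM_poly (K : comNzRingType) : {mpoly K[6]} := \det (CM_mx K).

Definition CM_diamond (K : comNzRingType) (x : 6.-tuple K) : Prop :=
  (CM_poly K).@[tnth x] = 0.

Definition dM (K : comNzRingType) (i : 'I_6) (x : 6.-tuple K) : K :=
  (mderiv i (CM_poly K)).@[tnth x].

Definition dM_up (K : comNzRingType) : 6.-tuple K -> K := dM pos_a.
Definition dM_down (K : comNzRingType) : 6.-tuple K -> K := dM pos_c.
Definition dM_left (K : comNzRingType) : 6.-tuple K -> K := dM pos_e.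
Definition dM_right (K : comNzRingType) : 6.-tuple K -> K := dM pos_f.

Definition Hpoly (K : comNzRingType) (p q r : K) : K :=
  - p ^+ 2 - q ^+ 2 - r ^+ 2 + 2 * p * q + 2 * p * r + 2 * q * r.

Definition star_eq (K : comNzRingType) (x1 x2 x3 x4 : 6.-tuple K) : Prop :=
  dM_left x1 * dM_right x4 = dM_up x2 * dM_down x3.

(* Main.v *)
Require Import Defs.
From mathcomp Require Import all_boot all_order all_algebra.
From mathcomp Require Import reals complex.
From mathcomp Require Import ring mpoly.

Import GRing.Theory Num.Theory.

Local Open Scope ring_scope.

(** [M] is quadratic in the entry of each edge, with leading coefficient [-2] times
    the entry of the opposite edge, and its discriminant is [4] times the product of
    the values of [H] on the two triangles containing the opposite edge.  On a diamond
    the square of a partial derivative of [M] is therefore a product of two [H]'s, up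
    to the factor [4]: this makes the coefficient of the unknown in the equation
    invertible.  Squaring the equation, the factors [H] shared by neighbouring diamonds
    cancel, so the squared derivative at the remaining tuple equals its discriminant,
    i.e. [M] vanishes there. *)

(** Cofactor expansion along the first row, with entries indexed by [nat] so that it computes by
    simplification at a concrete size. *)
Fixpoint laplace (K : comNzRingType) (n : nat) (F : nat -> nat -> K) : K :=
  if n is m.+1 then
    foldr (fun j s =>
        F 0%N j * (-1) ^+ j * laplace K m (fun i k => F i.+1 (bump j k)) + s)
      0 (iota 0 n)
  else 1.

Lemma det_laplace (K : comNzRingType) (n : nat) (F : nat -> nat -> K) :
  \det (\matrix_(i < n, j < n) F i j) = laplace K n F.
Proof.
elim: n F => [|n IHn] F; first exact: det_mx00.
transitivity (\sum_(0 <= j < n.+1)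
    F 0%N j * (-1) ^+ j * laplace K n (fun i k => F i.+1 (bump j k)));
  last by rewrite unlock.
rewrite (expand_det_row _ ord0) big_mkord; apply: eq_bigr => j _.
rewrite mxE /cofactor add0n mulrA -IHn; congr (_ * \det _).
by apply/matrixP => i k; rewrite !mxE.
Qed.

(** The classical expansion of 288 times the squared volume of a tetrahedron with squared edge
    lengths [a], ..., [f]: the opposite edges are [a],[c]; [b],[d]; [e],[f], and the subtracted
    products run over the four faces. *)
Definition CM_form (K : comNzRingType) (a b c d e f : K) : K :=
  2 * (a * c * (b + d + e + f - a - c) + b * d * (a + c + e + f - b - d)
       + e * f * (a + b + c + d - e - f)
       - (b * e * c + b * a * f + e * a * d + c * f * d)).

Lemma CM_poly_form (K : comNzRingType) :
  CM_poly K = CM_form {mpoly K[6]} 'X_pos_a 'X_pos_b 'X_pos_c 'X_pos_d 'X_pos_e 'X_pos_f.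
Proof.
rewrite /CM_poly /CM_mx /CM_form.
set a := 'X_pos_a; set b := 'X_pos_b; set c := 'X_pos_c.
set d := 'X_pos_d; set e := 'X_pos_e; set f := 'X_pos_f.
rewrite (det_laplace _ _ (fun i j => nth 0 (nth [::] _ i) j)) /= /bump /=.
rewrite ?(mul0r, mulr0, addr0, add0r).
ring.
Qed.

Lemma meval_CM (K : comNzRingType) (a b c d e f : K) :
  (CM_poly K).@[tnth [tuple a; b; c; d; e; f]] = CM_form K a b c d e f.
Proof.
rewrite CM_poly_form /CM_form.
rewrite !(mevalM, mevalB, mevalD, mevalN, mevalXU, mevalMn, meval1).
by rewrite !(tnth_nth 0).
Qed.

Section PartialDerivatives.

Variables (K : comNzRingType) (a b c d e f : K).

(** The product rule for a generic index: [D j] is the derivative of the variable [j], so choosing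
    [i] yields each partial derivative. *)
Let dME i : dM i [tuple a; b; c; d; e; f] =
  let X := tnth [tuple a; b; c; d; e; f] in
  let D j := (j == i)%:R : K in
  2 * ((D pos_a * c + a * D pos_c) * (b + d + e + f - a - c)
     + a * c * (D pos_b + D pos_d + D pos_e + D pos_f - D pos_a - D pos_c)
     + ((D pos_b * d + b * D pos_d) * (a + c + e + f - b - d)
     + b * d * (D pos_a + D pos_c + D pos_e + D pos_f - D pos_b - D pos_d))
     + ((D pos_e * f + e * D pos_f) * (a + b + c + d - e - f)
     + e * f * (D pos_a + D pos_b + D pos_c + D pos_d - D pos_e - D pos_f))
     - ((D pos_b * e + b * D pos_e) * c + b * e * D pos_c
      + ((D pos_b * a + b * D pos_a) * f + b * a * D pos_f)
      + ((D pos_e * a + e * D pos_a) * d + e * a * D pos_d)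
      + ((D pos_c * f + c * D pos_f) * d + c * f * D pos_d))).
Proof.
have evD j : (mderiv i 'X_j).@[tnth [tuple a; b; c; d; e; f]] = (j == i)%:R :> K.
  rewrite mderivX mnm1E mevalZ; case: eqP => [->|_]; last by rewrite mul0r.
  by rewrite mul1r -[X in (X - _)%MM]add0m addmK mpolyX0 meval1.
rewrite /dM CM_poly_form /CM_form.
rewrite mderivM mderivMn -mpolyC1 mderivC mul0rn mul0r add0r.
rewrite !(mderivM, mderivB, mderivD).
rewrite !(mevalM, mevalB, mevalD, mevalN, mevalXU, mevalMn, mevalC, evD).
by rewrite !(tnth_nth 0).
Qed.

Lemma dM_upE : dM_up [tuple a; b; c; d; e; f] =
  2 * (c * (b + d + e + f - 2 * a - c) + (b - e) * (d - f)).
Proof. by rewrite /dM_up dME /=; ring. Qed.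

Lemma dM_downE : dM_down [tuple a; b; c; d; e; f] =
  2 * (a * (b + d + e + f - 2 * c - a) + (b - f) * (d - e)).
Proof. by rewrite /dM_down dME /=; ring. Qed.

Lemma dM_leftE : dM_left [tuple a; b; c; d; e; f] =
  2 * (f * (a + b + c + d - 2 * e - f) + (a - b) * (c - d)).
Proof. by rewrite /dM_left dME /=; ring. Qed.

Lemma dM_rightE : dM_right [tuple a; b; c; d; e; f] =
  2 * (e * (a + b + c + d - 2 * f - e) + (a - d) * (c - b)).
Proof. by rewrite /dM_right dME /=; ring. Qed.

(** For a quadratic with leading coefficient [l], the squared derivative is the discriminant plus
    [4 * l] times the value; here [l = - 2 * c]. The last term is kept because the identity also
    serves at the tuple not yet known to be a diamond. *)
Lemma dM_up_sqr : dM_up [tuple a; b; c; d; e; f] ^+ 2 =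
  4 * Hpoly b c e * Hpoly c d f - 8 * c * CM_form K a b c d e f.
Proof. by rewrite dM_upE /Hpoly /CM_form; ring. Qed.

Lemma dM_down_sqr : dM_down [tuple a; b; c; d; e; f] ^+ 2 =
  4 * Hpoly a b f * Hpoly a d e - 8 * a * CM_form K a b c d e f.
Proof. by rewrite dM_downE /Hpoly /CM_form; ring. Qed.

Lemma dM_left_sqr : dM_left [tuple a; b; c; d; e; f] ^+ 2 =
  4 * Hpoly a b f * Hpoly c d f - 8 * f * CM_form K a b c d e f.
Proof. by rewrite dM_leftE /Hpoly /CM_form; ring. Qed.

Lemma dM_right_sqr : dM_right [tuple a; b; c; d; e; f] ^+ 2 =
  4 * Hpoly a d e * Hpoly b c e - 8 * e * CM_form K a b c d e f.
Proof. by rewrite dM_rightE /Hpoly /CM_form; ring. Qed.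

End PartialDerivatives.

Lemma Hpoly_swap12 (K : comNzRingType) (p q r : K) : Hpoly p q r = Hpoly q p r.
Proof. by rewrite /Hpoly; ring. Qed.

Lemma Hpoly_swap23 (K : comNzRingType) (p q r : K) : Hpoly p q r = Hpoly p r q.
Proof. by rewrite /Hpoly; ring. Qed.

(** Serves for the derivative [g] of [M] in the unknown edge, which is affine because [M] is
    quadratic there. *)
Lemma affine_eq_unique (K : fieldType) (g : K -> K) (m k p q : K) :
  (forall x, g x = k - m * x) -> m != 0 -> p != 0 -> exists! x, p * g x = q.
Proof.
move=> gE m0 p0; exists ((k - q / p) / m); split=> [|y <-]; rewrite gE; field.
  by rewrite m0.
by rewrite p0 m0.
Qed.

(** Cancelling [p ^+ 2] in the squared equation leaves [g ^+ 2 = D], hence [t * M = 0]. *)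
Lemma discriminant_zero (K : fieldType) (p q g t D M : K) :
  p != 0 -> t != 0 -> p * g = q -> q ^+ 2 = p ^+ 2 * D ->
  g ^+ 2 = D - t * M -> M = 0.
Proof.
move=> p0 t0 <- /eqP; rewrite exprMn (inj_eq (mulfI (expf_neq0 2 p0))) => /eqP ->.
by move/esym/eqP; rewrite -subr_eq0 addrAC subrr sub0r oppr_eq0 mulf_eq0 (negPf t0)
  => /eqP.
Qed.

Theorem proposition5p15 (R : realType) :
  (forall x12 x14 x15 x16 x23 x24 x25 x26 x34 x35 x45 x56 : complex R,
    let x1 := [tuple x15; x12; x24; x45; x14; x25] in
    let x2 := [tuple x16; x12; x25; x56; x15; x26] in
    let x3 := [tuple x25; x23; x34; x45; x24; x35] in
    let x4 := fun x36 : complex R => [tuple x26; x23; x35; x56; x25; x36] in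
    CM_diamond x1 -> CM_diamond x2 -> CM_diamond x3 ->
    x25 * Hpoly x24 x25 x45 * Hpoly x12 x15 x25 <> 0 ->
    (exists! x36 : complex R, star_eq x1 x2 x3 (x4 x36)) /\
    (forall x36 : complex R,
       star_eq x1 x2 x3 (x4 x36) -> CM_diamond (x4 x36))) /\
  (forall x12 x15 x16 x23 x24 x25 x26 x34 x35 x36 x45 x56 : complex R,
    let x1 := fun x14 : complex R => [tuple x15; x12; x24; x45; x14; x25] in
    let x2 := [tuple x16; x12; x25; x56; x15; x26] in
    let x3 := [tuple x25; x23; x34; x45; x24; x35] in
    let x4 := [tuple x26; x23; x35; x56; x25; x36] in
    CM_diamond x2 -> CM_diamond x3 -> CM_diamond x4 ->
    x25 * Hpoly x25 x26 x56 * Hpoly x23 x25 x35 <> 0 ->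
    (exists! x14 : complex R, star_eq (x1 x14) x2 x3 x4) /\
    (forall x14 : complex R,
       star_eq (x1 x14) x2 x3 x4 -> CM_diamond (x1 x14))).
Proof.
have natN0 n : (n.+1%:R : complex R) != 0 by rewrite pnatr_eq0.
split.
  move=> x12 x14 x15 x16 x23 x24 x25 x26 x34 x35 x45 x56 x1 x2 x3 x4.
  rewrite /CM_diamond !meval_CM => M1 M2 M3 /eqP.
  rewrite !mulf_eq0 !negb_or -andbA => /and3P[x25N0 H245 H125].
  have sq1 := dM_left_sqr _ x15 x12 x24 x45 x14 x25.
  have sq2 := dM_up_sqr _ x16 x12 x25 x56 x15 x26.
  have sq3 := dM_down_sqr _ x25 x23 x34 x45 x24 x35.
  rewrite M1 mulr0 subr0 in sq1.
  rewrite M2 mulr0 subr0 in sq2.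
  rewrite M3 mulr0 subr0 in sq3.
  (* Its square is four times H_125 H_245. *)
  have p0 : dM_left x1 != 0.
    rewrite -sqrf_eq0 sq1 !mulf_eq0 !negb_or natN0.
    by rewrite Hpoly_swap12 H125 Hpoly_swap23 H245.
  split.
    (* The slope in [x36] is [- 4 * x25]; the other constant is the derivative at [x36 = 0]. *)
    apply: (affine_eq_unique _ _ (4 * x25)
      (2 * (x25 * (x26 + x23 + x35 + x56 - x25) + (x26 - x56) * (x35 - x23))))
      => // [x36|].
      by rewrite dM_rightE; ring.
    by rewrite mulf_neq0.
  move=> x36 star; rewrite meval_CM.
  apply: (discriminant_zero _ _ _ _ (8 * x25) _ _ p0 _ star _
    (dM_right_sqr _ _ _ _ _ _ _)).
    by rewrite mulf_neq0.
  (* Both sides equal 16 H_125 H_245 H_256 H_235. *)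
  by rewrite exprMn sq1 sq2 sq3 /Hpoly; ring.
move=> x12 x15 x16 x23 x24 x25 x26 x34 x35 x36 x45 x56 x1 x2 x3 x4.
rewrite /CM_diamond !meval_CM => M2 M3 M4 /eqP.
rewrite !mulf_eq0 !negb_or -andbA => /and3P[x25N0 H256 H235].
have sq2 := dM_up_sqr _ x16 x12 x25 x56 x15 x26.
have sq3 := dM_down_sqr _ x25 x23 x34 x45 x24 x35.
have sq4 := dM_right_sqr _ x26 x23 x35 x56 x25 x36.
rewrite M2 mulr0 subr0 in sq2.
rewrite M3 mulr0 subr0 in sq3.
rewrite M4 mulr0 subr0 in sq4.
(* The roles of [x1] and [x4] are now exchanged: this square is four times H_256 H_235. *)
have p0 : dM_right x4 != 0.
  rewrite -sqrf_eq0 sq4 !mulf_eq0 !negb_or natN0.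
  rewrite [Hpoly x23 _ _]Hpoly_swap23 H235 andbT.
  by rewrite Hpoly_swap23 Hpoly_swap12 H256.
(* Puts the factor with the unknown second, as both field lemmas expect. *)
have starC x14 :
    star_eq (x1 x14) x2 x3 x4 <-> dM_right x4 * dM_left (x1 x14) = dM_up x2 * dM_down x3.
  by rewrite /star_eq mulrC.
split.
  have [x14 [sol uniq_sol]] : exists! x14,
      dM_right x4 * dM_left (x1 x14) = dM_up x2 * dM_down x3.
    apply: (affine_eq_unique _ _ (4 * x25)
      (2 * (x25 * (x15 + x12 + x24 + x45 - x25) + (x15 - x12) * (x24 - x45))))
      => // [x14|].
      by rewrite dM_leftE; ring.
    by rewrite mulf_neq0.
  by exists x14; split=> [|y /starC /uniq_sol //]; apply/starC.
move=> x14 /starC star; rewrite meval_CM.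
apply: (discriminant_zero _ _ _ _ (8 * x25) _ _ p0 _ star _
  (dM_left_sqr _ _ _ _ _ _ _)).
  by rewrite mulf_neq0.
by rewrite exprMn sq4 sq2 sq3 /Hpoly; ring.
Qed.
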